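(* Let $u\in B_\mu\subset S_\mu$, let $U$ be a neighborhood of $u$ in $S_\mu$, and let $B_\mu\cap\overline U$ be closed in $S_\mu$. Let $V:\overline U\to E$ be a Lipschitz mapping on $\overline U$ with $V(w)\in T_wS_\mu$ for any $w\in\overline U$, which satisfies $$\lim_{s\searrow0}s^{-1}\operatorname{dist}(w+sV(w),B_\mu)=0,\qquad\forall w\in\overline U\cap B_\mu .$$ Then there exist $r=r(u)>0$ and $\eta(t,u)$ satisfying $$\frac{\partial}{\partial t}\eta(t,u)=V(\eta(t,u))\quad\forall t\in[0,r),\qquad \eta(0,u)=u,\qquad \eta(t,u)\in B_\mu \quad \forall t\in[0,r).$$
   Context: $(E,\langle\cdot,\cdot\rangle)$ and $(H,(\cdot,\cdot))$ are two infinite-dimensional real Hilbert spaces with $E\hookrightarrow H\hookrightarrow E'$ with continuous injections; the injection $E\hookrightarrow H$ has norm at most $1$ and $E$ is identified with its image in $H$. For $u\in E$, $\|u\|^2=\langle u,u\rangle$ and $|u|^2=(u,u)$. For $\mu\in(0,\infty)$, $S_\mu=\{u\in E:|u|^2=\mu\}$ (with the topology of $E$), and for $w\in S_\mu$, $T_wS_\mu=\{\phi\in E:(\phi,w)=0\}$. The distance $\operatorname{dist}$ is taken with respect to the norm $\|\cdot\|$ of $E$. *)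

(* Defs.v *)
From HB Require Import structures.
From mathcomp Require Import all_boot all_order all_algebra.
From mathcomp Require Import sesquilinear.
From mathcomp Require Import all_classical all_reals all_analysis.

Set Implicit Arguments.
Unset Strict Implicit.
Unset Printing Implicit Defensive.

Import Order.TTheory GRing.Theory Num.Theory.
Import numFieldNormedType.Exports.

Local Open Scope classical_set_scope.
Local Open Scope ring_scope.

(* A real Hilbert space is a complete normed module V together with a positive
   definite symmetric bilinear form d : {dot V for idfun} inducing its norm. *)
Definition induces_norm (R : realType) (V : normedModType R)
    (d : {dot V for idfun}) : Prop :=
  forall u : V, `|u| ^+ 2 = d u u.

Definition infinite_dimensional (R : realType) (V : lmodType R) : Prop :=
  forall (n : nat) (e : 'I_n -> V),
    exists v : V, forall c : 'I_n -> R, v <> \sum_(i < n) c i *: e i.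

(* The map sending h to the functional u |-> (h, j u); when |j u| <= ||u|| it
   takes its values in E' and is continuous by Cauchy-Schwarz. *)
Definition to_dual (R : realType) (E H : normedModType R)
    (dH : {dot H for idfun}) (j : E -> H) : H -> E -> R :=
  fun h u => dH h (j u).

Definition sphere (R : realType) (E H : normedModType R)
    (j : E -> H) (mu : R) : set E :=
  [set u | `|j u| ^+ 2 = mu].

Definition tangent (R : realType) (E H : normedModType R)
    (dH : {dot H for idfun}) (j : E -> H) (w : E) : set E :=
  [set phi | dH (j phi) (j w) = 0].

Definition closure_in (T : topologicalType) (S U : set T) : set T :=
  closure (U : set (subspace S)).

Definition closed_in (T : topologicalType) (S C : set T) : Prop :=
  closed (C : set (subspace S)).

Definition neighborhood_in (T : topologicalType) (S : set T) (x : T)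
    (U : set T) : Prop :=
  U `<=` S /\ nbhs (x : subspace S) U.

(* Meaningful for nonempty A only: inf set0 = 0. *)
Definition dist (R : realType) (V : normedModType R) (x : V) (A : set V) : R :=
  inf [set `|x - a| | a in A].

(* On D = [0, r[ this is the two-sided derivative at interior points and the
   right derivative at 0. *)
Definition has_derivative_within (R : realType) (V : normedModType R)
    (D : set R) (f : R -> V) (t : R) (l : V) : Prop :=
  (s - t)^-1 *: (f s - f t) @[s --> within D t^'] --> l.

(* Main.v *)
(** Let K be the closed set of points of B lying in the closure of U.  The
    subtangency condition only provides steps of uncontrolled length along V,
    but since K is complete Zorn's lemma glues them: from w in K near u one
    reaches, for every small h, a point of K within C h^2 of w + h V(w), the
    constant C being uniform because V is Lipschitz.  Hence there are Euler
    schemes of arbitrary constant mesh staying in K.  Discrete Gronwall shows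
    that halving the mesh moves the scheme by O(h), so the dyadic schemes
    converge, without compactness, to a curve eta in K such that
    eta(t) = eta(s) + (t - s) V(eta(s)) + O((t - s)^2). *)
Require Import Defs.
From HB Require Import structures.
From mathcomp Require Import all_boot all_order all_algebra.
From mathcomp Require Import sesquilinear ring lra zify.
From mathcomp Require Import all_classical all_reals all_analysis.

Set Implicit Arguments.
Unset Strict Implicit.
Unset Printing Implicit Defensive.

Import Order.TTheory GRing.Theory Num.Theory.
Import numFieldNormedType.Exports.

Local Open Scope classical_set_scope.
Local Open Scope ring_scope.

(** * Completeness, and gluing of short steps by Zorn's lemma *)

Lemma cvg_cauchy_modulus (R : realType) (E : completeNormedModType R)
    (x : nat -> E) (e : nat -> R) :
  e @ \oo --> 0 ->
  (forall n m, (n <= m)%N -> `|x m - x n| <= e n) ->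
  exists l : E, x @ \oo --> l.
Proof.
move=> e0 xe.
suff /cauchy_cvgP : cauchy (x @ \oo) by exists (lim (x @ \oo)).
apply/cauchy_ballP => d d0.
have d20 : 0 < d / 2 by lra.
have [N _ eN] := cvgr_lt _ e0 _ d20.
suff xN k : (N <= k)%N -> `|x k - x N| < d / 2.
  exists ([set x k | k in [set k | (N <= k)%N]],
          [set x k | k in [set k | (N <= k)%N]]).
    by split; exists N => // k /= Nk; exists k.
  move=> [_ _] /= [[k Nk <-] [m Nm <-]].
  rewrite -ball_normE /ball_ /=.
  have := ler_distD (x N) (x k) (x m); rewrite (distrC (x N)).
  have := xN _ Nk; have := xN _ Nm; lra.
by move=> Nk; apply: le_lt_trans (xe _ _ Nk) (eN N (leqnn N)).
Qed.

(* Zorn's lemma for the order [s <= s'], [`|y' - y| <= c * (s' - s)] on [X]: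
   along a chain [y] is a [c]-Lipschitz function of [s], so by completeness and
   closedness chains have upper bounds. *)
Lemma closed_section (R : realType) (E : completeNormedModType R)
    (X : set (R * E)) (w : E) (c h : R) :
  closed X -> X (0, w) -> 0 <= c -> 0 <= h ->
  (forall s y, 0 <= s < h -> X (s, y) -> `|y - w| <= c * s ->
     exists s' y', [/\ s < s' <= h, X (s', y') & `|y' - y| <= c * (s' - s)]) ->
  exists2 y, X (h, y) & `|y - w| <= c * h.
Proof.
move=> clX X0 c0 h0 ext.
pose P (p : R * E) := [/\ 0 <= p.1 <= h, X p & `|p.2 - w| <= c * p.1].
pose T := {p : R * E | P p}.
pose le (p q : R * E) := (p.1 <= q.1) && (`|q.2 - p.2| <= c * (q.1 - p.1)).
have le_refl p : le p p by rewrite /le lexx !subrr normr0 mulr0 lexx.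
have le_tr p q r : le p q -> le q r -> le p r.
  move=> /andP[pq1 pq2] /andP[qr1 qr2]; apply/andP; split; first by lra.
  by have := ler_distD q.2 r.2 p.2; lra.
have P0 : P (0, w).
  by split=> //=; rewrite ?lexx ?h0// subrr normr0 mulr0.
have [||A totA|[p Pp] maxp] :=
  @ZL_preorder T (exist _ _ P0) (fun p q => le (sval p) (sval q)).
- by move=> t; exact: le_refl.
- by move=> r s t; exact: le_tr.
(* An empty chain is bounded by the base point [(0, w)]; for a nonempty one the bound sits at the
   supremum of the heights. *)
- have [[p0 Ap0]|A0] := pselect (A !=set0); last first.
    by exists (exist _ _ P0) => s As; case: A0; exists s.
  pose S := [set (sval p).1 | p in A].
  have S_h : ubound S h by move=> _ [[p [/= /andP[_ ph] _ _]] _ <-].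
  have S_sup : has_sup S by split; [exists (sval p0).1, p0|exists h].
  have S_ub p : A p -> (sval p).1 <= sup S.
    by move=> Ap; apply: ub_le_sup; [case: S_sup|exists p].
  have Sh : sup S <= h by apply: ge_sup => //; case: S_sup.
  have S0 : 0 <= sup S.
    by apply: le_trans (S_ub _ Ap0); case: (p0) => p /= [/andP[]].
  (* A sequence in the chain whose heights tend to the supremum; by totality of the chain ([cmp])
     its second components are Cauchy. *)
  have pick_ n : exists p, A p /\ sup S - n.+1%:R^-1 < (sval p).1.
    have n0 : 0 < n.+1%:R^-1 :> R by rewrite invr_gt0.
    by have [_ [p Ap <-] pn] := sup_adherent n0 S_sup; exists p.
  have [q Aq] := choice pick_.
  have cmp p p' : A p -> A p' ->
    `|(sval p').2 - (sval p).2| <= c * `|(sval p').1 - (sval p).1|.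
    move=> Ap Ap'; case: (totA _ _ Ap Ap') => /andP[le1 le2].
      by rewrite (ger0_norm (x := _ - _)) ?subr_ge0.
    by rewrite distrC (distrC _.1) (ger0_norm (x := _ - _)) ?subr_ge0.
  have q1 : (fun n => (sval (q n)).1) @ \oo --> sup S.
    apply/cvgrPdist_lt => e e0.
    have [N _ NP] := near_infty_natSinv_lt (PosNum e0).
    exists N => // n Nn /=; have [Aqn qn] := Aq n.
    have ne : n.+1%:R^-1 < e := NP n Nn.
    suff : `|sup S - (sval (q n)).1| < e by [].
    have := S_ub _ Aqn; move: qn ne; set a := _^-1.
    move: (sval (q n)).1 (sup S) a => x y a *.
    by rewrite ltr_norml; lra.
  have [l ql] : exists l : E, (fun n => (sval (q n)).2) @ \oo --> l.
    apply: (@cvg_cauchy_modulus _ _ _ (fun n => c * harmonic n)).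
      rewrite -[0 in X in _ --> X](mulr0 c).
      exact: (cvgM (cvg_cst c) cvg_harmonic).
    move=> n m nm; have [Aqn qn] := Aq n; have [Aqm qm] := Aq m.
    apply: le_trans (cmp _ _ Aqn Aqm) _; apply: ler_wpM2l => //=.
    have mn : m.+1%:R^-1 <= n.+1%:R^-1 :> R by rewrite lef_pV2 ?posrE// ler_nat.
    have := S_ub _ Aqm; have := S_ub _ Aqn; move: qn qm mn.
    rewrite /harmonic /=; set a := m.+1%:R^-1; set b := n.+1%:R^-1.
    move: a b (sval (q n)).1 (sval (q m)).1 (sup S) => a b x y z *.
    rewrite ler_norml; lra.
  have le_l p : A p -> `|l - (sval p).2| <= c * (sup S - (sval p).1).
    move=> Ap; rewrite -(ger0_norm (x := sup S - _)) ?subr_ge0 ?S_ub//.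
    have : (fun n => `|(sval (q n)).2 - (sval p).2|) @ \oo -->
        `|l - (sval p).2|.
      by apply: cvg_norm; apply: cvgB => //; exact: cvg_cst.
    move/ler_cvg_to; apply.
    - by apply: cvgM; [exact: cvg_cst|exact: cvg_norm (cvgB q1 (cvg_cst _))].
    - apply: nearW => n; have [Aqn _] := Aq n. exact: (cmp _ _ Ap Aqn).
  have Pl : P (sup S, l).
    split=> /=; first by rewrite S0.
      apply: (closed_cvg X clX (u_ := fun n => sval (q n)) (F := \oo)).
        by apply: nearW => n; case: (q n) => p [].
      rewrite (_ : (fun n => sval (q n)) =
        (fun n => ((sval (q n)).1, (sval (q n)).2))).
        by apply: (cvg_pair q1 ql).
      by apply/funext => n; case: (sval (q n)).
    have := le_l _ Ap0; have := ler_distD (sval p0).2 l w.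
    by case: (p0) => p [] /= ? ?; lra.
  exists (exist _ _ Pl) => p Ap; apply/andP; split; first exact: S_ub.
  exact: le_l.
(* If the maximal element had height [s < h], then [ext] would produce a strictly higher element
   above it. *)
case: p Pp maxp => s y Pp maxp; have [/= /andP[s0 sh] Xsy yw] := Pp.
have [sh'|hs] := ltP s h; last first.
  by have -> : h = s; [lra|exists y].
have [||s' [y' [/andP[ss' s'h] Xs'y' yy']]] := ext s y _ Xsy => //.
  by rewrite s0.
have Py' : P (s', y').
  split=> //=; first by lra.
  by have := ler_distD y y' w; lra.
have /(_ _)/andP[] := maxp (exist _ _ Py'); last by rewrite /=; lra.
by rewrite /le /= ltW.
Qed.

(** * Discrete estimates for Euler schemes *)

Lemma ler_distDD (R : numDomainType) (E : normedZmodType R) (a b p q : E) :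
  `|a + p - (b + q)| <= `|a - b| + `|p - q|.
Proof. by rewrite opprD addrACA; exact: ler_normD. Qed.

(** Induction on [m]: after time [m * h] the velocity has changed by at most [L * N * (m * h)], and
    the defects add up to [C * h * (m * h)]. The two errors are kept apart because the second
    vanishes with the mesh, while the first survives as the quadratic remainder of the limit
    curve. *)
Lemma euler_drift (R : realType) (E : normedModType R) (V : E -> E)
    (x : nat -> E) (n : nat) (h L N C : R) :
  0 <= h -> 0 <= L -> 0 <= N -> 0 <= C ->
  (forall i j, (i <= n)%N -> (j <= n)%N ->
     `|V (x i) - V (x j)| <= L * `|x i - x j|) ->
  (forall k, (k < n)%N -> `|x k.+1 - x k| <= N * h) ->
  (forall k, (k < n)%N -> `|x k.+1 - (x k + h *: V (x k))| <= C * h ^+ 2) ->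
  forall i m, (i + m <= n)%N ->
    `|x (i + m)%N - x i| <= N * (m%:R * h) /\
    `|x (i + m)%N - (x i + (m%:R * h) *: V (x i))| <=
      L * N * (m%:R * h) ^+ 2 + C * h * (m%:R * h).
Proof.
move=> h0 L0 N0 C0 lip speed defect i; elim=> [|m IHm] imn.
  by rewrite addn0 mul0r scale0r addr0 subrr normr0 expr0n !mulr0 addr0.
rewrite addnS in imn *; have [xm xm'] := IHm (ltnW imn).
rewrite -natr1 mulrDl mul1r; split.
  have := ler_distD (x (i + m)%N) (x (i + m).+1) (x i).
  by have := speed _ imn; lra.
rewrite scalerDl addrA.
have := ler_distD (x (i + m)%N + h *: V (x (i + m)%N)) (x (i + m).+1)
  (x i + (m%:R * h) *: V (x i) + h *: V (x i)).
have := ler_distDD (x (i + m)%N) (x i + (m%:R * h) *: V (x i))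
  (h *: V (x (i + m)%N)) (h *: V (x i)).
rewrite -scalerBr normrZ ger0_norm// => t1 t2.
have dV : h * `|V (x (i + m)%N) - V (x i)| <= h * (L * (N * (m%:R * h))).
  apply: ler_wpM2l => //; apply: le_trans (lip _ _ (ltnW imn) _) _.
    by apply: leq_trans (ltnW imn); rewrite leq_addr.
  exact: ler_wpM2l.
(* Up to the factor [L * N * h ^+ 2], this is the slack in [m ^ 2 + m <= (m + 1) ^ 2]. *)
have Nm : 0 <= L * N * h ^+ 2 * (m%:R + 1) by rewrite !mulr_ge0 ?addr_ge0.
by have := defect _ imn; move: t1 t2 xm' dV Nm; lra.
Qed.

(* Discrete Gronwall inequality: over a time [n * h <= 1 / (2 * L)] the
   exponential factor is at most 2. *)
Lemma euler_compare (R : realType) (E : normedModType R) (V : E -> E)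
    (x y : nat -> E) (n : nat) (h L a b : R) :
  0 <= h -> 0 <= L -> 0 <= a -> 0 <= b -> 2 * L * (n%:R * h) <= 1 ->
  x 0 = y 0 ->
  (forall k, (k <= n)%N -> `|V (x k) - V (y k)| <= L * `|x k - y k|) ->
  (forall k, (k < n)%N -> `|x k.+1 - (x k + h *: V (x k))| <= a) ->
  (forall k, (k < n)%N -> `|y k.+1 - (y k + h *: V (y k))| <= b) ->
  forall k, (k <= n)%N -> `|x k - y k| <= 2 * (a + b) * k%:R.
Proof.
move=> h0 L0 a0 b0 Lnh xy0 lip xa yb; elim=> [|k IHk] kn.
  by rewrite xy0 subrr normr0 mulr0.
have xyk := IHk (ltnW kn).
have := ler_distD (x k + h *: V (x k)) (x k.+1) (y k.+1).
have := ler_distD (y k + h *: V (y k)) (x k + h *: V (x k)) (y k.+1).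
have := ler_distDD (x k) (y k) (h *: V (x k)) (h *: V (y k)).
rewrite -scalerBr normrZ ger0_norm// => t1.
rewrite (distrC (y k + _)) => t2 t3.
have dV : h * `|V (x k) - V (y k)| <= h * (L * (2 * (a + b) * k%:R)).
  apply: ler_wpM2l => //; apply: le_trans (lip _ (ltnW kn)) _.
  exact: ler_wpM2l.
(* The short time span absorbs the Lipschitz feedback into [a + b], so each step adds at most
   [2 * (a + b)]. *)
have kh : h * (L * (2 * (a + b) * k%:R)) <= a + b.
  have -> : h * (L * (2 * (a + b) * k%:R)) = (a + b) * (2 * L * (k%:R * h)).
    by ring.
  rewrite ler_piMr ?addr_ge0//; apply: le_trans Lnh.
  by rewrite ler_wpM2l ?mulr_ge0// ler_wpM2r// ler_nat ltnW.
have := xa _ kn; have := yb _ kn.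
by rewrite -natr1; move: t1 t2 t3 dV kh xyk; lra.
Qed.

(** Steps are available only within [N * r] of [u]; since [k] steps move at most
    [N * (k * h) <= N * r], the iteration never leaves this ball. *)
Lemma euler_sequence (R : realType) (E : normedModType R) (K : set E)
    (V : E -> E) (u : E) (N C h r : R) (n : nat) :
  K u -> 0 <= N -> 0 < h -> n%:R * h <= r ->
  (forall w, K w -> `|w - u| <= N * r -> exists b,
     [/\ K b, `|b - w| <= N * h & `|b - (w + h *: V w)| <= C * h ^+ 2]) ->
  exists x : nat -> E,
    [/\ x 0 = u, forall k, (k <= n)%N -> K (x k),
        forall k, (k < n)%N -> `|x k.+1 - x k| <= N * h &
        forall k, (k < n)%N -> `|x k.+1 - (x k + h *: V (x k))| <= C * h ^+ 2].
Proof.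
move=> Ku N0 h0 nh step.
have /choice[T HT] w : exists b, K w -> `|w - u| <= N * r ->
    [/\ K b, `|b - w| <= N * h & `|b - (w + h *: V w)| <= C * h ^+ 2].
  have [[Kw wu]|Kw] := pselect (K w /\ `|w - u| <= N * r).
    by have [b ?] := step w Kw wu; exists b.
  (* A placeholder where no step is available; [inv] keeps the iterates away from this case. *)
  by exists w => ? ?; case: Kw.
have near k : (k <= n)%N -> N * (k%:R * h) <= N * r.
  move=> kn; apply: ler_wpM2l => //; apply: le_trans nh.
  by rewrite ler_pM2r// ler_nat.
have inv k : (k <= n)%N ->
    K (iter k T u) /\ `|iter k T u - u| <= N * (k%:R * h).
  elim: k => [|k IHk] kn; first by rewrite /= subrr normr0 mul0r mulr0.
  have [Kk ku] := IHk (ltnW kn).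
  have [KT Tk _] := HT _ Kk (le_trans ku (near _ (ltnW kn))).
  split=> //=; have := ler_distD (iter k T u) (T (iter k T u)) u.
  by rewrite -natr1; lra.
have good k : (k < n)%N -> _ := fun kn => let: conj Kk ku := inv k (ltnW kn) in
  HT _ Kk (le_trans ku (near _ (ltnW kn))).
exists (fun k => iter k T u); split=> // k kn.
- by case: (inv k kn).
- by case: (good k kn).
- by case: (good k kn).
Qed.

(** Two steps of mesh [h / 2] form one step of mesh [h] with defect at most [(L * N + C) * h ^+ 2],
    so [euler_compare] applies to [x] and every second point of [y]; the bound [k * h <= r] leaves
    one power of [h]. *)
Lemma euler_refine (R : realType) (E : normedModType R) (K : set E)
    (V : E -> E) (x y : nat -> E) (L N C h r : R) (n : nat) :
  0 <= L -> 0 <= N -> 0 <= C -> 0 <= h -> n%:R * h <= r -> 2 * L * r <= 1 ->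
  (forall w w', K w -> K w' -> `|V w - V w'| <= L * `|w - w'|) ->
  x 0 = y 0 ->
  (forall k, (k <= n)%N -> K (x k)) ->
  (forall k, (k < n)%N -> `|x k.+1 - (x k + h *: V (x k))| <= C * h ^+ 2) ->
  (forall k, (k <= n.*2)%N -> K (y k)) ->
  (forall k, (k < n.*2)%N -> `|y k.+1 - y k| <= N * (h / 2)) ->
  (forall k, (k < n.*2)%N ->
     `|y k.+1 - (y k + (h / 2) *: V (y k))| <= C * (h / 2) ^+ 2) ->
  forall k, (k <= n)%N -> `|x k - y k.*2| <= 2 * (L * N + 2 * C) * r * h.
Proof.
move=> L0 N0 C0 h0 nh Lr lip xy0 Kx dx Ky sy dy k kn.
have b0 : 0 <= (L * N + C) * h ^+ 2.
  by rewrite mulr_ge0 ?exprn_ge0// addr_ge0 ?mulr_ge0.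
have a0 : 0 <= C * h ^+ 2 by rewrite mulr_ge0 ?exprn_ge0.
have Lnh : 2 * L * (n%:R * h) <= 1.
  by apply: le_trans Lr; rewrite ler_wpM2l ?mulr_ge0.
have d2 j : (j < n)%N -> `|y j.+1.*2 - (y j.*2 + h *: V (y j.*2))| <=
    (L * N + C) * h ^+ 2.
  move=> jn; have h20 : 0 <= h / 2 by lra.
  have [||_] := euler_drift h20 L0 N0 C0 _ sy dy (i := j.*2) (m := 2).
  - by move=> a b an bn; apply: lip; apply: Ky.
  - by rewrite addn2 -doubleS leq_double.
  rewrite addn2 -doubleS (_ : 2%:R * (h / 2) = h); last by field.
  by move: a0; lra.
have := euler_compare h0 L0 a0 b0 Lnh xy0 (y := fun k => y k.*2) _ dx d2 kn.
move=> /(_ _)/le_trans; apply.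
  by move=> j jn; apply: lip; [exact: Kx|apply: Ky; rewrite leq_double].
have kr : k%:R * h <= r by apply: le_trans nh; rewrite ler_wpM2r// ler_nat.
have c0 : 0 <= 2 * (L * N + 2 * C) * h.
  by rewrite !mulr_ge0 ?addr_ge0 ?mulr_ge0.
have := ler_wpM2l c0 kr; lra.
Qed.

(** * Passage to the limit of the dyadic schemes *)

(** Limit form of the second estimate of [euler_drift]: [p] lies in the closed set [K], where the
    Lipschitz bound makes [V (a n)] tend to [V p]. *)
Lemma cvg_quadratic_bound (R : realType) (E : normedModType R) (K : set E)
    (V : E -> E) (a b : nat -> E) (d h : nat -> R) (p q : E) (t L A C : R) :
  closed K ->
  (forall w w', K w -> K w' -> `|V w - V w'| <= L * `|w - w'|) ->
  a @ \oo --> p -> b @ \oo --> q -> d @ \oo --> t -> h @ \oo --> 0 ->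
  (forall n, K (a n)) ->
  (forall n, `|b n - (a n + d n *: V (a n))| <= A * d n ^+ 2 + C * h n * d n) ->
  `|q - (p + t *: V p)| <= A * t ^+ 2.
Proof.
move=> clK lip ap bq dt h0 Ka abd.
have Kp : K p.
  by apply: (closed_cvg K clK (u_ := a) (F := \oo)) => //; exact: nearW.
have Va : (fun n => V (a n)) @ \oo --> V p.
  apply/cvgrPdist_le => e e0.
  (* A positive divisor whatever the sign of [L]. *)
  have L1 : 0 < `|L| + 1 by rewrite ltr_wpDl.
  have /cvgrPdist_le/(_ _ (divr_gt0 e0 L1)) := ap.
  apply: filterS => n; rewrite ler_pdivlMr// => pa.
  apply: le_trans (lip _ _ Kp (Ka n)) _; apply: le_trans pa.
  rewrite mulrC ler_wpM2l//; have := ler_norm L; lra.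
have lhs : (fun n => `|b n - (a n + d n *: V (a n))|) @ \oo -->
    `|q - (p + t *: V p)|.
  by apply: cvg_norm; apply: cvgB => //; apply: cvgD => //; exact: cvgZ.
have rhs : (fun n => A * (d n * d n) + C * h n * d n) @ \oo -->
    A * (t * t) + C * 0 * t.
  apply: cvgD; last by apply: cvgM => //; apply: cvgM => //; exact: cvg_cst.
  by apply: cvgM; [exact: cvg_cst|exact: cvgM].
have := ler_cvg_to lhs rhs; rewrite mulr0 mul0r addr0; apply.
exact: nearW.
Qed.

Lemma has_derivative_within_quadratic (R : realType) (E : normedModType R)
    (D : set R) (f : R -> E) (t A : R) (l : E) :
  (forall s, D s -> `|f s - f t - (s - t) *: l| <= A * (s - t) ^+ 2) ->
  has_derivative_within D f t l.
Proof.
move=> fA; apply/cvgrPdist_le => e e0.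
have A1 : 0 < `|A| + 1 by rewrite ltr_wpDl.
rewrite near_withinE; apply: filterS (dnbhs_ball t (divr_gt0 e0 A1)) => s.
rewrite -ball_normE => -[/= ts /eqP st] Ds.
have st0 : s - t != 0 by rewrite subr_eq0.
rewrite distrC -{1}(scalerK st0 l) -scalerBr normrZ normfV.
rewrite ler_pdivrMl ?normr_gt0//; apply: le_trans (fA _ Ds) _.
rewrite -(real_normK (num_real (s - t))) (distrC s t).
move: ts; rewrite ltr_pdivlMr//; move: `|t - s| (normr_ge0 (t - s)) => d d0 de.
have := ler_norm A; have := normr_ge0 A; move: `|A| de => a de a0 Aa.
rewrite expr2 mulrA [leRHS]mulrC ler_wpM2r//.
by have := ler_wpM2r d0 Aa; lra.
Qed.

(** The curve is the pointwise limit of the step functions [phi m], constant between grid points of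
    mesh [r / 2 ^ m]. The constant [C] is absent from the conclusion because its contribution
    carries a factor of the mesh. *)
Lemma euler_limit (R : realType) (E : completeNormedModType R) (K : set E)
    (V : E -> E) (u : E) (L N C r : R) :
  closed K -> K u -> 0 <= L -> 0 <= N -> 0 <= C -> 0 < r -> 2 * L * r <= 1 ->
  (forall w w', K w -> K w' -> `|V w - V w'| <= L * `|w - w'|) ->
  (forall h w, 0 < h <= r -> K w -> `|w - u| <= N * r -> exists b,
     [/\ K b, `|b - w| <= N * h & `|b - (w + h *: V w)| <= C * h ^+ 2]) ->
  exists eta : R -> E, eta 0 = u /\
    forall s t, 0 <= s -> s <= t -> t < r ->
    [/\ K (eta s), `|eta t - eta s| <= N * (t - s) &
      `|eta t - (eta s + (t - s) *: V (eta s))| <= L * N * (t - s) ^+ 2].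
Proof.
move=> clK Ku L0 N0 C0 r0 Lr lip step.
pose h m : R := r / 2 ^+ m.
have p2 m : 0 < 2 ^+ m :> R by rewrite exprn_gt0.
have h_gt0 m : 0 < h m by rewrite divr_gt0.
have h_half m : h m.+1 = h m / 2 by rewrite /h exprS invfM mulrCA mulrC.
have nh m : (2 ^ m)%N%:R * h m = r by rewrite natrX /h mulrC divfK ?gt_eqF.
have h_le m : h m <= r.
  by rewrite ler_pdivrMr// ler_peMr ?exprn_ege1 ?ler1n// ltW.
have h_cvg : h @ \oo --> 0.
  have -> : h = geometric r 2^-1.
    by apply/funext => m; rewrite /h /geometric /= exprVn.
  by apply: cvg_geometric; rewrite ger0_norm; lra.
have /choice[X HX] m : exists x : nat -> E,
    [/\ x 0 = u, forall k, (k <= 2 ^ m)%N -> K (x k),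
        forall k, (k < 2 ^ m)%N -> `|x k.+1 - x k| <= N * h m &
        forall k, (k < 2 ^ m)%N ->
          `|x k.+1 - (x k + h m *: V (x k))| <= C * h m ^+ 2].
  apply: (@euler_sequence _ _ _ _ _ _ _ _ r) => //; first by rewrite nh.
  by move=> w; apply: step; rewrite h_gt0 h_le.
(* Index of the last grid point not after [t]; for [t < r] it is below [2 ^ m], so a step of the
   scheme starts there. *)
pose k m (t : R) := Num.truncn (t / h m).
have k_itv m t : 0 <= t -> (k m t)%:R * h m <= t < ((k m t)%:R + 1) * h m.
  move=> t0; rewrite -ler_pdivlMr// -ltr_pdivrMr// natr1.
  by apply: truncn_itv; rewrite divr_ge0 // ltW.
have k_lt m t : 0 <= t -> t < r -> (k m t < 2 ^ m)%N.
  move=> t0 tr; rewrite -(ltr_nat R) -(ltr_pM2r (h_gt0 m)) nh.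
  by have /andP[] := k_itv m t t0; lra.
have k_double m t : 0 <= t ->
    k m.+1 t = (k m t).*2 \/ k m.+1 t = (k m t).*2.+1.
  move=> t0; have /andP[a1 a2] := k_itv m t t0.
  have /andP[b1 b2] := k_itv m.+1 t t0; rewrite h_half in b1 b2.
  have c1 : ((k m t).*2%:R < (k m.+1 t).+1%:R :> R).
    by rewrite -(ltr_pM2r (h_gt0 m)) -mul2n natrM -natr1; lra.
  have c2 : ((k m.+1 t)%:R < (k m t).*2.+2%:R :> R).
    by rewrite -(ltr_pM2r (h_gt0 m)) -mul2n -addn2 natrD natrM; lra.
  rewrite !ltr_nat in c1 c2; lia.
pose phi m t := X m (k m t).
(* The first summand compares the two schemes at a common grid time; the extra [N] pays for the half
   step made when the finer grid has a later last point. *)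
pose Q := 2 * (L * N + 2 * C) * r + N.
have phi_step m t : 0 <= t -> t < r -> `|phi m.+1 t - phi m t| <= Q * h m.
  move=> t0 tr; have km := k_lt m t t0 tr.
  have [x0 Kx sx dx] := HX m; have [y0 Ky sy dy] := HX m.+1.
  rewrite h_half expnS mul2n in Ky sy dy.
  have := @euler_refine _ _ K V (X m) (X m.+1) L N C (h m) r (2 ^ m).
  rewrite nh x0 y0 => /(_ _ _ _ _ _ _ lip erefl Kx dx Ky sy dy _ (ltnW km)).
  move=> /(_ L0 N0 C0 (ltW (h_gt0 m)) (lexx _) Lr) xy.
  have Nh : 0 <= N * h m by rewrite mulr_ge0 // ltW.
  rewrite /phi /Q; case: (k_double m t t0) => ->.
    by rewrite distrC; lra.
  have := sy (k m t).*2; rewrite ltn_double km => /(_ isT).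
  have := ler_distD (X m.+1 (k m t).*2) (X m.+1 (k m t).*2.+1) (X m (k m t)).
  by rewrite (distrC (X m.+1 (k m t).*2) (X m _)); lra.
have phi_cauchy t : 0 <= t -> t < r -> forall n m, (n <= m)%N ->
    `|phi m t - phi n t| <= 2 * Q * h n.
  (* Since the mesh halves, [Q * h m = 2 * Q * (h m - h m.+1)], and the bounds telescope. *)
  move=> t0 tr n m nm; suff : `|phi m t - phi n t| <= 2 * Q * (h n - h m).
    have Q0 : 0 <= Q * h m.
      by rewrite mulr_ge0 ?addr_ge0 ?mulr_ge0 ?addr_ge0 ?mulr_ge0// ltW.
    by lra.
  elim: m nm => [|m IHm].
    by rewrite leqn0 => /eqP ->; rewrite !subrr normr0 mulr0.
  rewrite leq_eqVlt => /orP[/eqP <-|nm]; first by rewrite !subrr normr0 mulr0.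
  have := IHm nm; have := phi_step m t t0 tr; rewrite h_half.
  by have := ler_distD (phi m t) (phi m.+1 t) (phi n t); lra.
have /choice[eta eta_lim] (t : R) : exists l : E,
    0 <= t -> t < r -> phi^~ t @ \oo --> l.
  have [/andP[t0 tr]|tP] := boolP (0 <= t < r); last first.
    by exists u => t0 tr; rewrite t0 tr in tP.
  have [|l phil] := cvg_cauchy_modulus _ (phi_cauchy t t0 tr); last by exists l.
  by rewrite -(mulr0 (2 * Q)); exact: (cvgM (cvg_cst _) h_cvg).
have phi_K t m : 0 <= t -> t < r -> K (phi m t).
  by move=> t0 tr; case: (HX m) => _ + _ _; apply; apply/ltnW/k_lt.
exists eta; split.
  have phi0 : phi^~ 0 = cst u.
    by apply/funext => m; rewrite /phi /k mul0r truncn0; case: (HX m).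
  have := eta_lim 0 (lexx _) r0; rewrite phi0 => /cvg_lim <- //.
  by rewrite lim_cst.
move=> s t s0 st tr.
have t0 := le_trans s0 st; have sr := le_lt_trans st tr.
have es := eta_lim s s0 sr; have et := eta_lim t t0 tr.
(* Time between the grid points used for [s] and [t]; it differs from [t - s] by less than one
   mesh. *)
pose d m : R := (k m t - k m s)%:R * h m.
have k_le m : (k m s <= k m t)%N.
  by apply: le_truncn; rewrite ler_pM2r ?invr_gt0.
have d_cvg : d @ \oo --> t - s.
  apply/cvgrPdist_lt => e e0.
  have /cvgrPdist_lt/(_ _ e0) := h_cvg; apply: filterS => m.
  rewrite sub0r normrN ger0_norm ?ltW// => he.
  suff dm : `|t - s - d m| < e by exact: dm.
  have /andP[a1 a2] := k_itv m t t0; have /andP[b1 b2] := k_itv m s s0.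
  by rewrite /d natrB// ltr_norml; lra.
have drift_ m : `|phi m t - phi m s| <= N * d m /\
    `|phi m t - (phi m s + d m *: V (phi m s))| <=
      L * N * d m ^+ 2 + C * h m * d m.
  have [_ Kx sx dx] := HX m.
  have [||] := euler_drift (ltW (h_gt0 m)) L0 N0 C0 _ sx dx (i := k m s)
    (m := (k m t - k m s)%N).
  - by move=> i j ? ?; apply: lip; apply: Kx.
  - by rewrite subnKC// ltnW ?k_lt.
  by rewrite subnKC.
split.
- by apply: (closed_cvg K clK (u_ := phi^~ s) (F := \oo)) => //;
    apply: nearW => m; exact: phi_K.
- have := ler_cvg_to (cvg_norm (cvgB et es)) (cvgM (cvg_cst N) d_cvg); apply.
  by apply: nearW => m; case: (drift_ m).
- apply: (cvg_quadratic_bound (a := phi^~ s) (b := phi^~ t) (C := C)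
    clK lip es et d_cvg h_cvg).
    by move=> m; exact: phi_K.
  by move=> m; case: (drift_ m).
Qed.

(** * Steps of prescribed length from the subtangency condition *)

Lemma dist_lt_ex (R : realType) (E : normedModType R) (x : E) (A : set E)
    (e : R) :
  A !=set0 -> dist x A < e -> exists2 a, A a & `|x - a| < e.
Proof.
move=> [a0 Aa0] /inf_lt[|_ [a Aa <-] ?]; last by exists a.
by exists `|x - a0|, a0.
Qed.

(** With the velocity frozen at [V w], points of [K] are written [y + s *: V w], and
    [closed_section] runs in [s], controlling only the drift [y]. A subtangent step of length [tau]
    from [b] errs by less than [tau * h], and replacing [V b] by [V w] costs at most
    [tau * (L * N * h)]; so [y] moves at speed [c = (1 + L * N) * h], which over time [h] gives
    order [h ^+ 2]. *)
Lemma subtangent_step (R : realType) (E : completeNormedModType R)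
    (B K : set E) (V : E -> E) (u : E) (L N rho r : R) :
  closed K -> K `<=` B -> 0 <= L ->
  (forall w w', K w -> K w' -> `|V w - V w'| <= L * `|w - w'|) ->
  (forall b, B b -> `|b - u| <= rho -> K b) ->
  (forall w, K w -> `|w - u| <= rho -> `|V w| + 1 <= N) ->
  (forall w, K w ->
     s^-1 * dist (w + s *: V w) B @[s --> (0 : R)^'+] --> (0 : R)) ->
  2 * (N * r) <= rho -> (1 + L * N) * r <= 1 ->
  forall h w, 0 < h <= r -> K w -> `|w - u| <= N * r -> exists b,
     [/\ K b, `|b - w| <= N * h &
         `|b - (w + h *: V w)| <= (1 + L * N) * h ^+ 2].
Proof.
move=> clK KB L0 lip BK VN sub Nr Cr h w /andP[h0 hr] Kw wu.
have r0 := lt_le_trans h0 hr.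
have wrho : `|w - u| <= rho by have := normr_ge0 (w - u); lra.
have VwN := VN _ Kw wrho.
have N1 : 1 <= N by have := normr_ge0 (V w); lra.
pose c := (1 + L * N) * h.
have c0 : 0 <= c by rewrite mulr_ge0 ?addr_ge0 ?mulr_ge0//; lra.
have c1 : c <= 1.
  by apply: le_trans Cr; rewrite ler_wpM2l ?addr_ge0 ?mulr_ge0//; lra.
(* The 1 added to [|V w|] in the bound by [N] leaves room for the drift, whose speed is [c <= 1]. *)
have near s y : 0 <= s <= h -> `|y - w| <= c * s ->
    `|y + s *: V w - w| <= N * s.
  move=> /andP[s0 sh] yw.
  have := ler_distDD y w (s *: V w) 0.
  rewrite addr0 subr0 normrZ ger0_norm//.
  have : s * `|V w| <= s * (N - 1) by rewrite ler_wpM2l//; lra.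
  have : c * s <= s by rewrite ler_piMl.
  by lra.
have [|||||y Ky yw] := @closed_section _ _
  [set p : R * E | K (p.2 + p.1 *: V w)] w c h.
- apply: (closed_comp (f := fun p : R * E => p.2 + p.1 *: V w)) => // p _.
  by apply: cvgD; [exact: cvg_snd|apply: cvgZr_tmp; exact: cvg_fst].
- by rewrite /= scale0r addr0.
- exact: c0.
- exact: ltW.
- move=> s y /andP[s0 sh] /= Kb yw.
  set b := y + s *: V w in Kb.
  have bw : `|b - w| <= N * s by apply: near => //; rewrite s0 ltW.
  have hs : 0 < h - s by lra.
  have Btau : \forall tau \near (0 : R)^'+, dist (b + tau *: V b) B < tau * h.
    have /cvgrPdist_lt/(_ _ h0) := sub _ Kb; apply: filter_app; near=> tau.
    have tau0 : 0 < tau by [].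
    rewrite sub0r normrN => /(le_lt_trans (ler_norm _)).
    by rewrite ltr_pdivrMl.
  have [tau [Btau_ tau0 tauh]] : exists tau,
      [/\ dist (b + tau *: V b) B < tau * h, 0 < tau & tau <= h - s].
    near (0 : R)^'+ => tau; exists tau; split=> //; first by near: tau.
    by near: tau; exact: nbhs_right_le.
  have [|b' Bb' bb'] := dist_lt_ex _ Btau_; first by exists b; exact: KB.
  (* The new drift is chosen so that adding back [(s + tau) *: V w] gives [b']. *)
  exists (s + tau), (b' - (s + tau) *: V w).
  have yy' : `|b' - (s + tau) *: V w - y| <= c * (s + tau - s).
    have -> : b' - (s + tau) *: V w - y = b' - (b + tau *: V w).
      by rewrite -addrA -opprD [_ + y]addrC scalerDl addrA.
    have := ler_distD (b + tau *: V b) b' (b + tau *: V w).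
    have := ler_distDD b b (tau *: V b) (tau *: V w).
    rewrite subrr normr0 -scalerBr normrZ gtr0_norm//.
    rewrite (distrC b' (b + tau *: V b)) => t1 t2.
    have : tau * `|V b - V w| <= tau * (L * (N * h)).
      rewrite ler_wpM2l ?(ltW tau0)//; apply: le_trans (lip _ _ Kb Kw) _.
      rewrite ler_wpM2l//; apply: le_trans bw _.
      by rewrite ler_wpM2l ?ltW//; lra.
    by rewrite /c; move: t1 t2 bb'; lra.
  split=> //; first lra.
  (* The point [b'] of [B] is within [N * h] of [w], hence within [2 * (N * r) <= rho] of [u]. *)
  rewrite subrK; apply: BK => //.
  have sth : 0 <= s + tau <= h by lra.
  have y'w : `|b' - (s + tau) *: V w - w| <= c * (s + tau).
    have := ler_distD y (b' - (s + tau) *: V w) w.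
    by move: yy' yw; lra.
  have := near _ _ sth y'w; rewrite subrK.
  have : N * (s + tau) <= N * r by rewrite ler_wpM2l//; lra.
  by have := ler_distD w b' u; lra.
- exists (y + h *: V w); split=> //.
    by apply: near => //; rewrite lexx ltW.
  by rewrite opprD addrACA subrr addr0 expr2 mulrA.
Unshelve. all: by end_near. Qed.

(** * The sphere, its subspace topology, and Lipschitz constants *)

Lemma closed_sphere (R : realType) (E H : normedModType R)
    (j : {linear E -> H}) (mu : R) :
  (forall x, `|j x| <= `|x|) -> closed (sphere j mu).
Proof.
move=> j1; apply: (closed_comp (f := fun x => `|j x| ^+ 2) (D := [set mu])).
  move=> x _; suff jx : `|j y| @[y --> x] --> `|j x| by exact: (cvgM jx jx).
  apply: cvg_norm; apply/cvgrPdist_lt => e e0.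
  near=> y; rewrite -linearB; apply: le_lt_trans (j1 _) _; near: y.
  exact: cvgr_dist_lt.
exact: closed_eq.
Unshelve. all: by end_near. Qed.

Lemma closed_in_closed (T : topologicalType) (S C : set T) :
  closed S -> C `<=` S -> closed_in S C -> closed C.
Proof.
move=> clS CS /closed_subspaceP[F clF FC].
by rewrite -(setIidl CS) -FC; exact: closedI.
Qed.

Lemma neighborhood_in_ball (R : realType) (E : normedModType R) (S U : set E)
    (u : E) : S u -> neighborhood_in S u U ->
  exists2 d : R, 0 < d & forall x, S x -> `|x - u| < d -> U x.
Proof.
move=> Su [_ nbhsU].
have /nbhs_normP[d /= d0 dU] : within S (nbhs u) U.
  by rewrite (nbhs_subspace_in Su).
by exists d => // x Sx xu; apply: dU => //=; rewrite distrC.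
Qed.

Lemma lipschitz_in_ex (R : realType) (E F : normedModType R) (V : E -> F)
    (A : set E) : [lipschitz V w | w in A] ->
  exists2 L, 0 <= L &
    forall w w', A w -> A w' -> `|V w - V w'| <= L * `|w - w'|.
Proof.
(* Every constant strictly above [M] is a Lipschitz constant; this one is also nonnegative. *)
move=> [M [_ MV]]; exists (Num.max M 0 + 1).
  by rewrite addr_ge0// le_max lexx orbT.
have M1 : M < Num.max M 0 + 1.
  by rewrite (@le_lt_trans _ _ (Num.max M 0)) ?le_max ?lexx// ltrDl.
by move=> w w' Aw Aw'; exact: (MV _ M1 (w, w')).
Qed.

(** * Choice of the constants and construction of the integral curve *)

Theorem proposition4p5 (R : realType) (E H : completeNormedModType R)
    (dE : {dot E for idfun}) (dH : {dot H for idfun})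
    (hdE : induces_norm dE) (hdH : induces_norm dH)
    (infE : infinite_dimensional E) (infH : infinite_dimensional H)
    (j : {linear E -> H}) (j_inj : injective j)
    (j_norm : forall u : E, `|j u| <= `|u|)
    (dual_inj : injective (to_dual dH j))
    (mu : R) (mu_gt0 : 0 < mu)
    (B U : set E) (u : E) (V : E -> E)
    (B_sub : B `<=` sphere j mu) (Bu : B u)
    (U_nbhs : neighborhood_in (sphere j mu) u U)
    (BU_closed : closed_in (sphere j mu) (B `&` closure_in (sphere j mu) U))
    (V_lip : [lipschitz V w | w in closure_in (sphere j mu) U])
    (V_tan : forall w : E, closure_in (sphere j mu) U w -> tangent dH j w (V w))
    (V_sub : forall w : E, (closure_in (sphere j mu) U `&` B) w ->
      s^-1 * dist (w + s *: V w) B @[s --> (0 : R)^'+] --> (0 : R)) :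
  exists (r : R) (eta : R -> E),
    [/\ 0 < r,
        forall t : R, 0 <= t < r ->
          closure_in (sphere j mu) U (eta t) /\
          has_derivative_within [set` `[0, r[ ] eta t (V (eta t)),
        eta 0 = u &
        forall t : R, 0 <= t < r -> B (eta t)].
Proof.
have [L L0 lipD] := lipschitz_in_ex V_lip.
set D := closure_in (sphere j mu) U in BU_closed V_sub lipD *.
pose K := B `&` D.
have UD : U `<=` D by exact: (@subset_closure (subspace (sphere j mu))).
have KS : K `<=` sphere j mu by move=> x [/B_sub].
(* The sphere is closed in [E], so relative closedness of [K] becomes closedness in a complete
   space. *)
have clK : closed K := closed_in_closed (closed_sphere j_norm) KS BU_closed.
have [d d0 dU] := neighborhood_in_ball (B_sub _ Bu) U_nbhs.
have BK b : B b -> `|b - u| <= d / 2 -> K b.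
  by move=> Bb bu; split=> //; apply/UD/dU; [exact: B_sub|lra].
have Ku : K u by apply: BK => //; rewrite subrr normr0 ltW// divr_gt0.
have lip w w' : K w -> K w' -> `|V w - V w'| <= L * `|w - w'|.
  by move=> [_ Dw] [_ Dw']; exact: lipD.
(* By the Lipschitz bound, [|V|] is at most [N - 1] on the part of [K] within [d / 2] of [u]. *)
pose N := `|V u| + L * (d / 2) + 1.
have Ld : 0 <= L * (d / 2) by rewrite mulr_ge0// ltW// divr_gt0.
have N1 : 1 <= N by rewrite /N; have := normr_ge0 (V u); lra.
have VN w : K w -> `|w - u| <= d / 2 -> `|V w| + 1 <= N.
  move=> Kw wu; rewrite /N lerD2r.
  have := ler_distD (V u) (V w) 0; rewrite !subr0.
  have := lip _ _ Kw Ku; have := ler_wpM2l L0 wu; lra.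
have C0 : 0 <= 1 + L * N by rewrite addr_ge0 ?mulr_ge0//; lra.
have C1 : 1 + L <= 1 + L * N by rewrite lerD2l ler_peMr.
(* The first bound gives [(1 + L * N) * r <= 1 / 2], hence also [2 * L * r <= 1] because [N >= 1];
   the second keeps the steps within [d / 2] of [u]. *)
pose r := Num.min (2 * (1 + L * N))^-1 (d / (4 * N)).
have r0 : 0 < r by rewrite lt_min invr_gt0 divr_gt0//; lra.
have rC : (1 + L * N) * r <= 2^-1.
  have : (1 + L * N) * r <= (1 + L * N) * (2 * (1 + L * N))^-1.
    by rewrite ler_wpM2l// ge_min lexx.
  by rewrite invfM mulrCA divff ?mulr1//; lra.
have rN : 2 * (N * r) <= d / 2.
  have : N * r <= N * (d / (4 * N)).
    by rewrite ler_wpM2l ?ge_min ?lexx ?orbT//; lra.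
  by rewrite invfM mulrCA (mulrCA N) divff ?mulr1; lra.
have Lr : 2 * L * r <= 1.
  by have := ler_wpM2r (ltW r0) C1; lra.
have KB : K `<=` B by move=> w [].
have K_sub w : K w ->
    s^-1 * dist (w + s *: V w) B @[s --> (0 : R)^'+] --> (0 : R).
  by move=> [Bw Dw]; exact: V_sub.
have Cr : (1 + L * N) * r <= 1 by lra.
have step := subtangent_step clK KB L0 lip BK VN K_sub rN Cr.
have N0 : 0 <= N by lra.
have [eta [eta0 eta_t]] := euler_limit clK Ku L0 N0 C0 r0 Lr lip step.
have etaK t : 0 <= t < r -> K (eta t).
  by move=> /andP[t0 tr]; case: (eta_t t t t0 (lexx _) tr).
exists r, eta; split=> // t t_itv; last by case: (etaK t t_itv).
split; first by case: (etaK t t_itv).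
have /andP[t0 tr] := t_itv.
(* For [s >= t] the constant [L * N] suffices; for [s < t] the expansion is based at [s], and
   exchanging [V (eta s)] for [V (eta t)] costs another [L * N * (t - s) ^+ 2]. *)
apply: (@has_derivative_within_quadratic _ _ _ _ _ (2 * (L * N))) => s /=.
rewrite in_itv /= => /andP[s0 sr].
have LN0 : 0 <= L * N by rewrite mulr_ge0//; lra.
have [ts|/ltW st] := leP t s.
  have [_ _] := eta_t t s t0 ts sr; rewrite opprD addrA => /le_trans; apply.
  by rewrite ler_wpM2r ?exprn_ge0 ?subr_ge0//; lra.
have [_ e1 e2] := eta_t s t s0 st tr.
have -> : eta s - eta t - (s - t) *: V (eta t) =
    - (eta t - (eta s + (t - s) *: V (eta t))).
  by rewrite opprB -[s - t]opprB scaleNr opprK addrAC.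
rewrite normrN.
have := ler_distD (eta s + (t - s) *: V (eta s)) (eta t)
  (eta s + (t - s) *: V (eta t)).
have := ler_distDD (eta s) (eta s)
  ((t - s) *: V (eta s)) ((t - s) *: V (eta t)).
rewrite subrr normr0 -scalerBr normrZ ger0_norm ?subr_ge0//.
have : (t - s) * `|V (eta s) - V (eta t)| <= (t - s) * (L * (N * (t - s))).
  rewrite ler_wpM2l ?subr_ge0//.
  apply: le_trans (lip _ _ (etaK s _) (etaK t t_itv)) _.
    by rewrite s0 sr.
  by rewrite ler_wpM2l// distrC.
by move: e2; lra.
Qed.
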